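(* Let $S$ be a multiplicatively closed subset of a ring $R$, let $M$ be an $R$-module and let $N$ be a submodule of $M$ with $(N:_{R}M)\cap S=\emptyset$. The following are equivalent. (1) $N$ is an $S$-$1$-absorbing primary submodule of $M$. (2) There exists $s\in S$ such that, for every proper ideal $I$ of $R$, every non-unit $b\in R$ and every $m\in M$, if $Ibm\subseteq N$, then $sIb\subseteq (N:_{R}M)$ or $sm\in M\text{-}rad(N)$. (3) There exists $s\in S$ such that, for all proper ideals $I,J$ of $R$ and every $m\in M$, if $IJm\subseteq N$, then $sIJ\subseteq (N:_{R}M)$ or $sm\in M\text{-}rad(N)$. (4) There exists $s\in S$ such that, for all proper ideals $I,J$ of $R$ and every submodule $K$ of $M$, if $IJK\subseteq N$, then $sIJ\subseteq (N:_{R}M)$ or $sK\subseteq M\text{-}rad(N)$.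
   Context: All rings are commutative with non-zero identity and all modules are unital. For a submodule $N$ of an $R$-module $M$, $(N:_{R}M)=\{r\in R\mid rM\subseteq N\}$. A prime submodule of $M$ is a proper submodule $P$ such that $rm\in P$ ($r\in R$, $m\in M$) implies $r\in(P:_RM)$ or $m\in P$. $M\text{-}rad(N)$ is the intersection of all prime submodules of $M$ containing $N$ (it equals $M$ if there are none). A submodule $N$ of $M$ with $(N:_{R}M)\cap S=\emptyset$ is called $S$-$1$-absorbing primary if there exists a fixed $s\in S$ such that for all non-unit $a,b\in R$ and all $m\in M$, if $abm\in N$, then $sab\in(N:_{R}M)$ or $sm\in M\text{-}rad(N)$. *)

(* Defs.v *)
From HB Require Import structures.
From mathcomp Require Import all_boot all_algebra.
From mathcomp Require Import boolp classical_sets.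
Set Implicit Arguments.
Unset Strict Implicit.
Unset Printing Implicit Defensive.
Import GRing.Theory.
Local Open Scope classical_set_scope.
Local Open Scope ring_scope.

(* The closure predicates take boolean predicates;
   [in A] is the (classical) boolean membership predicate of A : set T. *)

(* 1 \in S and S is closed under products; 0 is not excluded. *)
Definition mult_closed (R : comUnitRingType) (S : set R) : Prop :=
  GRing.mulr_closed [in S].

Definition submodule (R : comUnitRingType) (M : lmodType R) (N : set M) : Prop :=
  GRing.submod_closed [in N].

(* Ideals are the submodules of the regular module R^o. *)
Definition ideal (R : comUnitRingType) (I : set R) : Prop :=
  @submodule R R^o I.

Definition properIdeal (R : comUnitRingType) (I : set R) : Prop :=
  ideal I /\ I `<` setT.

Definition colon (R : comUnitRingType) (M : lmodType R) (N : set M) : set R :=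
  [set r | [set r *: m | m in setT] `<=` N].

Definition primeSubmodule (R : comUnitRingType) (M : lmodType R) (P : set M) :
    Prop :=
  [/\ submodule P, P `<` setT &
      forall (r : R) (m : M), P (r *: m) -> colon P r \/ P m].

(* When no prime submodule contains N, the empty intersection is setT. *)
Definition Mrad (R : comUnitRingType) (M : lmodType R) (N : set M) : set M :=
  \bigcap_(P in [set P | primeSubmodule P /\ N `<=` P]) P.

(* I K: the submodule generated by all products r *: k. *)
Definition prodIM (R : comUnitRingType) (M : lmodType R) (I : set R)
    (K : set M) : set M :=
  smallest (@submodule R M) [set r *: k | r in I & k in K].

(* I J: the ideal generated by all products i * j. *)
Definition prodII (R : comUnitRingType) (I J : set R) : set R :=
  smallest (@ideal R) [set i * j | i in I & j in J].

Definition S_1_absorbing_primary (R : comUnitRingType) (M : lmodType R)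
    (S : set R) (N : set M) : Prop :=
  [/\ submodule N, colon N `&` S = set0 &
      exists2 s : R, S s &
        forall (a b : R) (m : M),
          a \isn't a GRing.unit -> b \isn't a GRing.unit ->
          N ((a * b) *: m) -> colon N (s * a * b) \/ Mrad N (s *: m)].

(* Main.v *)
Require Import Defs.
From HB Require Import structures.
From mathcomp Require Import all_boot all_algebra.
From mathcomp Require Import boolp classical_sets.
Set Implicit Arguments.
Unset Strict Implicit.
Unset Printing Implicit Defensive.
Import GRing.Theory.
Local Open Scope classical_set_scope.
Local Open Scope ring_scope.

(** Going from elements to ideals to submodules is a matter of picking
    witnesses, with the same [s] kept throughout.  The conclusion is a
    disjunction whose second half does not mention [I] and [J]: if
    [sIJ <= (N : M)] fails, it already fails on a single generator [i * j] of
    [I J] (lemma [prodII_scale_sub]: the scalars sending a given vector into a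
    submodule form an ideal, so they contain [I J] as soon as they contain its
    generators).  The entries [i], [j] of that generator are not units because
    [I] and [J] are proper, so the hypothesis for elements applies to them and
    yields [s m] in the radical.  Applying this to each vector of a submodule
    [K] separately passes from vectors to submodules, since the failure of
    [sIJ <= (N : M)] is independent of the vector.  Conversely, the case of
    submodules gives back the one of elements for the principal ideals [Ra],
    [Rb] and the cyclic submodule [Rm]. *)

Section Submodules.

Variables (R : comUnitRingType) (M : lmodType R).
Implicit Types (N : set M) (I J : set R) (m : M).

Lemma submoduleP N :
  submodule N <-> N 0 /\ forall (r : R) u v, N u -> N v -> N (r *: u + v).
Proof.
rewrite /submodule /GRing.submod_closed; split=> -[N0 NL].
  split=> [|r u v Nu Nv]; first exact/set_mem.
  by apply/set_mem/(NL r); apply/mem_set.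
split=> [|r u v /set_mem Nu /set_mem Nv]; first exact/mem_set.
exact/mem_set/NL.
Qed.

Lemma submoduleZ N r m : submodule N -> N m -> N (r *: m).
Proof. by move=> /submoduleP[N0 NL] Nm; rewrite -[r *: m]addr0; exact: NL. Qed.

Lemma colonP N r : colon N r <-> forall m, N (r *: m).
Proof.
by split=> [Nr m|Nr _ [m _ <-]]; [apply: Nr; exists m | exact: Nr].
Qed.

Lemma submodule_cyclic m : submodule [set r *: m | r in setT].
Proof.
apply/submoduleP; split=> [|r _ _ [x _ <-] [y _ <-]].
  by exists 0; rewrite ?scale0r.
by exists (r * x + y) => //; rewrite scalerDl scalerA.
Qed.

Lemma ideal_scale_sub N m : submodule N -> ideal [set x : R | N (x *: m)].
Proof.
move=> /submoduleP[N0 NL]; rewrite /ideal /submodule /GRing.submod_closed.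
split=> [|r x y /set_mem /= Nx /set_mem /= Ny]; apply/mem_set => /=.
  by rewrite scale0r.
by rewrite scalerDl -scalerA; exact: NL.
Qed.

(** The product ideal is the smallest ideal containing the products, and the
    scalars sending [m] into [N] form an ideal.  Taking [s *: m] for [m], this
    also governs the inclusions [sIJ <= (N : M)]. *)
Lemma prodII_scale_sub N I J m : submodule N ->
    (forall i j, I i -> J j -> N ((i * j) *: m)) ->
  forall x, prodII I J x -> N (x *: m).
Proof.
move=> sN NIJ; apply: (smallest_sub (ideal_scale_sub m sN)).
by move=> _ [i Ii [j Jj <-]]; exact: NIJ.
Qed.

End Submodules.

Lemma prodII_mul (R : comUnitRingType) (I J : set R) i j :
  I i -> J j -> prodII I J (i * j).
Proof. by move=> Ii Jj; apply: sub_gen_smallest; exists i => //; exists j. Qed.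

Lemma properIdeal_nunit (R : comUnitRingType) (I : set R) i :
  properIdeal I -> I i -> i \isn't a GRing.unit.
Proof.
move=> [sI [_ nTI]] Ii; apply/negP => Ui; apply: nTI => r _.
have := @submoduleZ R R^o I (r / i) i sI Ii.
by rewrite [_ *: _]divrK.
Qed.

Lemma properIdeal_principal (R : comUnitRingType) (a : R) :
  a \isn't a GRing.unit -> properIdeal [set r * a | r in setT].
Proof.
move=> nUa; split; first exact: (@submodule_cyclic R R^o a).
split=> // /(_ 1 Logic.I)[r _ ra1]; move/negP: nUa; apply.
by apply/unitrP; exists r; rewrite ra1 mulrC ra1.
Qed.

Theorem theorem1 (R : comUnitRingType) (S : set R) (M : lmodType R)
    (N : set M) (hS : mult_closed S) (hN : submodule N)
    (hNS : colon N `&` S = set0) :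
  [<-> S_1_absorbing_primary S N;
       exists2 s : R, S s &
         forall (I : set R) (b : R) (m : M),
           properIdeal I -> b \isn't a GRing.unit ->
           [set (i * b) *: m | i in I] `<=` N ->
           [set s * (i * b) | i in I] `<=` colon N \/ Mrad N (s *: m);
       exists2 s : R, S s &
         forall (I J : set R) (m : M),
           properIdeal I -> properIdeal J ->
           [set x *: m | x in prodII I J] `<=` N ->
           [set s * x | x in prodII I J] `<=` colon N \/ Mrad N (s *: m);
       exists2 s : R, S s &
         forall (I J : set R) (K : set M),
           properIdeal I -> properIdeal J -> submodule K ->
           prodIM (prodII I J) K `<=` N ->
           [set s * x | x in prodII I J] `<=` colon N \/
           [set s *: k | k in K] `<=` Mrad N].
Proof.
tfae.
- case=> _ _ [s Ss abs]; exists s => // I b m pI nUb IbmN.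
  apply: contrapT => /not_orP[/existsNP[_ /not_implyP[[i Ii <-] nsib]] nRsm].
  have [|//] := abs i b m (properIdeal_nunit pI Ii) nUb (IbmN _ (imageP _ Ii)).
  by rewrite -mulrA.
- case=> s Ss abs; exists s => // I J m pI pJ IJmN.
  have [?|nRsm] := pselect (Mrad N (s *: m)); [by right | left].
  move=> _ [x IJx <-]; apply/colonP => u.
  rewrite mulrC -scalerA.
  apply: (prodII_scale_sub hN _ IJx) => i j Ii Jj.
  have IjmN : [set (i * j) *: m | i in I] `<=` N.
    by move=> _ [k Ik <-]; apply: IJmN; exists (k * j) => //; exact: prodII_mul.
  have [sIj|//] := abs I j m pI (properIdeal_nunit pJ Jj) IjmN.
  by rewrite scalerA mulrC; move: u; apply/colonP/sIj; exists i.
- case=> s Ss abs; exists s => // I J K pI pJ sK IJKN.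
  have [?|nsIJ] := pselect ([set s * x | x in prodII I J] `<=` colon N);
    [by left | right].
  move=> _ [k Kk <-].
  have IJkN : [set x *: k | x in prodII I J] `<=` N.
    move=> _ [x IJx <-]; apply: IJKN; apply: sub_gen_smallest.
    by exists x => //; exists k.
  by have [|] := abs I J k pI pJ IJkN.
- case=> s Ss abs; split=> //; exists s => // a b m nUa nUb abmN.
  set I := [set r * a | r in setT]; set J := [set r * b | r in setT].
  set K := [set r *: m | r in setT].
  have IJKN : prodIM (prodII I J) K `<=` N.
    apply: (smallest_sub hN) => _ [x IJx [_ [r _ <-] <-]].
    rewrite scalerA mulrC -scalerA; apply: (submoduleZ _ hN).
    apply: (prodII_scale_sub hN _ IJx) => _ _ [c _ <-] [d _ <-].
    by rewrite mulrACA -scalerA; exact: submoduleZ.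
  have [sIJ|sK] := abs I J K (properIdeal_principal nUa)
      (properIdeal_principal nUb) (submodule_cyclic m) IJKN.
  + left; rewrite -mulrA; apply: sIJ; exists (a * b) => //.
    by apply: prodII_mul; exists 1; rewrite ?mul1r.
  + by right; apply: sK; exists m => //; exists 1; rewrite ?scale1r.
Qed.
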